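(* Let $G$ be a connected graph of order $n$ with diameter $d\geq3$. Then $$\partial^Q_1(G)>2n-4+2d.$$ Further, if $d\geq4$, then $\partial^Q_1(G)>\frac{d(n+2)}{2}$.
   Context: All graphs are finite, simple, undirected and connected; $d(u,v)$ is graph distance and the diameter is the maximum distance between two vertices. The transmission of $v$ is $Tr(v)=\sum_u d(v,u)$; $Tr(G)$ is the diagonal matrix of transmissions, $D(G)$ the distance matrix, and the distance signless Laplacian matrix is $\mathcal{Q}(G)=Tr(G)+D(G)$, with eigenvalues $\partial^Q_1(G)\geq\cdots\geq\partial^Q_n(G)$. *)

(* Defs.v *)
From HB Require Import structures.
From mathcomp Require Import all_boot all_order all_algebra.
From mathcomp Require Import polyrcf.
From mathcomp Require Import reals.

Set Implicit Arguments.
Unset Strict Implicit.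
Unset Printing Implicit Defensive.

Import Order.TTheory GRing.Theory Num.Theory.

Local Open Scope ring_scope.

Section Graph.
Variables (T : finType) (e : rel T).

Definition simple_graph : Prop := symmetric e /\ irreflexive e.

Definition connected_graph : Prop := forall u v : T, connect e u v.

Definition walk_of_length (u v : T) (k : nat) : bool :=
  [exists p : k.-tuple T, path e u p && (last u p == v)].

(* The least length of a walk from u to v. Lengths below #|T| suffice, since a
   shortest walk repeats no vertex; for unconnected u, v the value is #|T|. *)
Definition dist (u v : T) : nat := find (walk_of_length u v) (iota 0 #|T|).

Definition diameter : nat := (\max_(u : T) \max_(v : T) dist u v)%N.

Definition transmission (v : T) : nat := (\sum_(u : T) dist v u)%N.

Variable R : realType.

(* Rows and columns are indexed by the vertices through enum_val. *)
Definition distance_mx : 'M[R]_#|T| :=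
  \matrix_(i, j) (dist (enum_val i) (enum_val j))%:R.

Definition transmission_mx : 'M[R]_#|T| :=
  diag_mx (\row_i (transmission (enum_val i))%:R).

Definition distance_signless_laplacian : 'M[R]_#|T| :=
  transmission_mx + distance_mx.

End Graph.

(* The real eigenvalues of A in nonincreasing order, each repeated according to
   its multiplicity as a root of the characteristic polynomial. *)
Definition eigenvalues (R : realType) (n : nat) (A : 'M[R]_n) : seq R :=
  sort (fun x y => y <= x)
    (flatten [seq nseq (mup a (char_poly A)) a | a <- rootsR (char_poly A)]).

(* The k-th largest distance signless Laplacian eigenvalue, k counted from 1. *)
Definition dsl_eigenvalue (R : realType) (T : finType) (e : rel T) (k : nat) : R :=
  (eigenvalues (distance_signless_laplacian e R))`_k.-1.

Lemma connected_walk_dist (T : finType) (e : rel T) (u v : T) :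
  connect e u v -> walk_of_length e u v (dist e u v).
Proof.
move=> /connectP [p0 p0P ->].
case/shortenP: p0P => p pP Up _.
have szp : (size p < #|T|)%N by rewrite -[(size p).+1]/(size (u :: p)) -(card_uniqP Up) max_card.
have h : has (walk_of_length e u (last u p)) (iota 0 #|T|).
  apply/hasP; exists (size p); first by rewrite mem_iota.
  by apply/existsP; exists (in_tuple p); rewrite pP eqxx.
have := nth_find 0%N h; rewrite nth_iota //.
by move: h; rewrite has_find size_iota.
Qed.

Lemma dist_le_walk (T : finType) (e : rel T) (u : T) (p : seq T) :
  path e u p -> (dist e u (last u p) <= size p)%N.
Proof.
move=> pP; rewrite leqNgt; apply/negP => lt_p.
have ltT : (size p < #|T|)%N.
  by rewrite (leq_trans lt_p) // -[X in (_ <= X)%N](size_iota 0) find_size.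
have := before_find 0%N lt_p; rewrite nth_iota // add0n => /negbT/negP; apply.
by apply/existsP; exists (in_tuple p); rewrite pP eqxx.
Qed.

Lemma mem_eigenvalues (R : realType) (n : nat) (A : 'M[R]_n) (a : R) :
  (a \in eigenvalues A) = eigenvalue A a.
Proof.
have p0 : char_poly A != 0 by rewrite monic_neq0 ?char_poly_monic.
have rE b : (b \in rootsR (char_poly A)) = root (char_poly A) b.
  by rewrite -(roots_on_rootsR p0) inE.
rewrite mem_sort eigenvalue_root_char.
apply/flattenP/idP => [[s /mapP[b]]|ra].
  by rewrite rE => rb -> /nseqP[-> _].
exists (nseq (mup a (char_poly A)) a); first by apply/mapP; exists a; rewrite ?rE.
by rewrite mem_nseq eqxx andbT -XsubC_dvd // dvdp_XsubCl.
Qed.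

Lemma eigenvalues_sorted (R : realType) (n : nat) (A : 'M[R]_n) :
  sorted (fun x y => y <= x) (eigenvalues A).
Proof. by apply: sort_sorted => x y; apply: le_total. Qed.

(* Main.v *)
(** The largest eigenvalue of a symmetric matrix exceeds every constant that the
    Rayleigh quotient of some vector exceeds.  The quadratic form of the distance
    signless Laplacian is the sum of d(a,b) x_a (x_a + x_b) over all (a, b).
    Take u, v at distance d and the vector equal to s on u and v and to t on the
    m = n - 2 other vertices.  By the triangle inequality d(u,a) + d(v,a) >= d,
    so the form is at least 4 d s^2 + d m (s+t)^2 + 2 m (m-1) t^2.  The choice
    s = 3, t = 1 gives more than 2n + 2 if d = 3; the choice s = m + 4, t = 1
    gives more than d (n+2) / 2, which is at least 2n - 4 + 2d if d >= 4. *)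
Require Import Defs.
From mathcomp Require Import all_boot all_order all_algebra.
From mathcomp Require Import spectral sesquilinear complex ring lra reals.

Import Order.TTheory GRing.Theory Num.Theory.
Local Open Scope ring_scope.

(** * Rayleigh quotients of real symmetric matrices *)

(** Over [R[i]] the matrix is Hermitian, hence unitarily diagonalizable with real spectrum. In the
    coordinates [y] of [x] in an eigenbasis, the form is the sum of [D 0 i * |y_i|^2], and each
    [D 0 i] is at most [c]. *)
Lemma symmetric_form_le (R : rcfType) (n : nat) (A : 'M[R]_n) (c : R) :
    A^T = A -> (forall a, eigenvalue A a -> a <= c) ->
  forall x : 'rV_n, (x *m A *m x^T) 0 0 <= c * (x *m x^T) 0 0.
Proof.
move=> symA maxA x.
pose toC : {rmorphism R -> R[i]} := real_complex R.
have toC_le a b : (toC a <= toC b) = (a <= b) by rewrite lecR.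
have toC_conj a : (toC a)^* = toC a by exact: conjc_real.
pose B := map_mx toC A; pose P := spectralmx B; pose D := spectral_diag B.
have hermB : B \is hermsymmx.
  apply: realsym_hermsym; last first.
    by apply/mxOverP => i j; rewrite mxE; apply/CrealP; rewrite toC_conj.
  apply/is_hermitianmxP; rewrite expr0 scale1r map_mx_id //.
  by rewrite /B map_trmx symA.
have BE : B = invmx P *m diag_mx D *m P.
  by apply/orthomx_spectralP; exact: hermitian_normalmx.
have Punit : P \in unitmx := spectral_unit B.
have PV : invmx P = map_mx Num.conj P^T.
  by rewrite invmx_unitary ?spectral_unitarymx.
have D_le i : D 0 i <= toC c.
  have /complex_realP [d Dd] := mxOverP (hermitian_spectral_diag_real hermB) 0 i.
  rewrite -/D in Dd; rewrite Dd toC_le; apply: maxA.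
  (* The rows of [P] are left eigenvectors of [B]; they are nonzero because [P] is invertible. Being
     an eigenvalue then descends from [R[i]] to [R]. *)
  rewrite -(eigenvalue_map toC); apply/eigenvalueP; exists (row i P).
    have -> : toC d = D 0 i by rewrite Dd.
    rewrite -/B BE -!row_mul !mulmxA mulmxV // mul1mx row_mul row_diag_mx.
    by rewrite -scalemxAl -rowE.
  apply/eqP => Pi0; have := row_mul i P (invmx P).
  rewrite Pi0 mul0mx mulmxV // => /rowP/(_ i); rewrite !mxE eqxx.
  by apply/eqP; rewrite oner_eq0.
pose y := map_mx toC x *m invmx P.
have formE (E : 'rV_n) :
    (map_mx toC x *m (invmx P *m diag_mx E *m P) *m (map_mx toC x)^T) 0 0
      = \sum_i E 0 i * `|y 0 i| ^+ 2.
  have conj_y : P *m (map_mx toC x)^T = map_mx Num.conj y^T.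
    have conj2 : map_mx Num.conj (invmx P)^T = P.
      by apply/matrixP => i j; rewrite PV !mxE conjCK.
    rewrite trmx_mul map_mxM conj2.
    by congr (_ *m _); apply/matrixP=> i j; rewrite !mxE; apply: esym; apply: toC_conj.
  rewrite !mulmxA -/y -mulmxA conj_y mxE; apply: eq_bigr => i _.
  by rewrite mul_mx_diag !mxE normCK mulrA [E 0 i * _]mulrC.
suff: toC ((x *m A *m x^T) 0 0) <= toC (c * (x *m x^T) 0 0) by rewrite toC_le.
rewrite rmorphM /=.
have mapE (M : 'M[R]_1) : toC (M 0 0) = map_mx toC M 0 0 by rewrite mxE.
rewrite !mapE !map_mxM -map_trmx -/B BE formE.
(* The diagonal of ones turns [formE] into the identity for the squared norm. *)
have := formE (const_mx 1); rewrite diag_const_mx mulmx1 mulVmx // mulmx1 => ->.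
rewrite mulr_sumr; apply: ler_sum => i _; rewrite [const_mx _ _ _]mxE mul1r.
by rewrite ler_wpM2r // exprn_ge0.
Qed.

Lemma symmetric_form_lt_eigenvalue1 {R : realType} {n : nat} {A : 'M[R]_n} {c : R}
    (x : 'rV_n) :
  A^T = A -> c * (x *m x^T) 0 0 < (x *m A *m x^T) 0 0 ->
  c < (eigenvalues A)`_0.
Proof.
move=> symA; rewrite !ltNge; apply: contra => max_c.
apply: symmetric_form_le => // a; rewrite -mem_eigenvalues => Aa.
apply: le_trans max_c; have := eigenvalues_sorted A.
(* The list contains [a], so its head is a genuine entry and not the default 0. *)
case: (eigenvalues A) Aa => //= b s; rewrite inE => /predU1P[-> //|sa].
rewrite path_sortedE; last by move=> z u v uz /le_trans; apply.
by case/andP => /allP/(_ _ sa).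
Qed.

(** * Graph distance as a metric, and the diameter *)

Lemma dist_walk {T : finType} {e : rel T} (u v : T) : connected_graph e ->
  exists p, [/\ path e u p, last u p = v & size p = dist e u v].
Proof.
move=> /(_ u v)/connected_walk_dist/existsP[p /andP[pP /eqP lp]].
by exists p; rewrite size_tuple.
Qed.

Lemma dist_sym {T : finType} {e : rel T} : symmetric e -> connected_graph e ->
  forall u v, dist e u v = dist e v u.
Proof.
move=> sym_e conn_e.
suff le_dist u v : (dist e v u <= dist e u v)%N; first move=> u v.
  by apply/eqP; rewrite eqn_leq !le_dist.
(* A shortest walk reversed is a walk of the same length. *)
have [p [pP <- <-]] := dist_walk u v conn_e.
have := dist_le_walk (e := e) (u := last u p) (p := rev (belast u p)).
rewrite rev_path size_rev size_belast (eq_path (e' := e)) // => /(_ pP).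
by case: p {pP} => //= a p; rewrite rev_cons last_rcons.
Qed.

Lemma dist_triangle {T : finType} {e : rel T} (u v w : T) : connected_graph e ->
  (dist e u w <= dist e u v + dist e v w)%N.
Proof.
move=> conn_e; have [p [pP <- <-]] := dist_walk u v conn_e.
have [q [qP <- <-]] := dist_walk (last u p) w conn_e.
by rewrite -size_cat -last_cat dist_le_walk // cat_path pP.
Qed.

Lemma dist_gt0 {T : finType} {e : rel T} {u v : T} : connected_graph e ->
  u != v -> (0 < dist e u v)%N.
Proof.
move=> conn_e; have [[|a p] [_ <- <-]] // := dist_walk u v conn_e.
by rewrite eqxx.
Qed.

Lemma dist_le_card {T : finType} (e : rel T) (u v : T) : (dist e u v <= #|T|)%N.
Proof. by rewrite -[X in (_ <= X)%N](size_iota 0) find_size. Qed.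

Lemma diameter_attained (T : finType) (e : rel T) : (0 < diameter e)%N ->
  exists u v, dist e u v = diameter e.
Proof.
(* An empty maximum is 0, so a positive diameter forces a vertex to exist. *)
move=> d0; have T0 : (0 < #|T|)%N.
  rewrite lt0n; apply: contraTneq d0 => /card0_eq T0.
  by rewrite -leqNgt /diameter big_pred0 // => x; have := T0 x.
rewrite /diameter; have [u ->] := bigop.eq_bigmax (fun u => \max_v dist e u v)%N T0.
by have [v ->] := bigop.eq_bigmax (dist e u) T0; exists u, v.
Qed.

(** * The quadratic form and its value on two-level vectors *)

Lemma dsl_sym (R : realType) (T : finType) (e : rel T) : (forall u v, dist e u v = dist e v u) ->
  (distance_signless_laplacian e R)^T = distance_signless_laplacian e R.
Proof.
move=> sym_d; rewrite linearD /= tr_diag_mx; congr (_ + _).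
by apply/matrixP => i j; rewrite !mxE sym_d.
Qed.

Lemma dsl_form (R : realType) (T : finType) (e : rel T) (f : T -> R)
    (x := \row_i f (enum_val i) : 'rV_#|T|) : (forall u v, dist e u v = dist e v u) ->
  (x *m distance_signless_laplacian e R *m x^T) 0 0 =
  \sum_a f a * \sum_b (dist e a b)%:R * (f a + f b).
Proof.
move=> sym_d.
rewrite (big_enum_val (A := T)) mxE; apply: eq_bigr => j _.
rewrite mulmxDr mul_mx_diag !mxE mulrC; congr (_ * _).
rewrite (eq_bigr _ (fun b _ => mulrDr _ _ _)) big_split /=; congr (_ + _).
  by rewrite -mulr_suml mulrC -natr_sum.
rewrite (big_enum_val (A := T)); apply: eq_bigr => i _.
by rewrite !mxE sym_d mulrC.
Qed.

Lemma dot_row_enum_val (R : realType) (T : finType) (f : T -> R)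
    (x := \row_i f (enum_val i) : 'rV_#|T|) :
  (x *m x^T) 0 0 = \sum_a f a * f a.
Proof.
by rewrite (big_enum_val (A := T)) mxE; apply: eq_bigr => j _; rewrite !mxE.
Qed.

Lemma big_two_rest {R : pzSemiRingType} {T : finType} {u v : T} (F : T -> R) : u != v ->
  \sum_a F a = F u + F v + \sum_(a | (a != u) && (a != v)) F a.
Proof.
by move=> uv; rewrite (bigD1 u) //= (bigD1 v) ?addrA //= eq_sym.
Qed.

Lemma card_two_rest {T : finType} {u v : T} : u != v ->
  #|T| = #|[pred a | (a != u) && (a != v)]|.+2.
Proof.
move=> uv; rewrite -!sum1_card (bigD1 u) //= (bigD1 v) //= eq_sym //.
Qed.

Definition two_level {R : Type} {T : eqType} (u v : T) (s t : R) (a : T) : R :=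
  if (a == u) || (a == v) then s else t.

Lemma dsl_two_level_ge (R : realType) (T : finType) (e : rel T) (u v : T)
    (s t : R) (f := two_level u v s t) (d := (dist e u v)%:R : R)
    (m := #|[pred a | (a != u) && (a != v)]|%:R : R) :
    symmetric e -> connected_graph e -> u != v -> 0 <= s -> 0 <= t ->
  4 * d * s ^+ 2 + d * m * (s + t) ^+ 2 + 2 * m * (m - 1) * t ^+ 2
    <= \sum_a f a * \sum_b (dist e a b)%:R * (f a + f b).
Proof.
move=> sym_e conn_e uv s0 t0.
have sym_d := dist_sym sym_e conn_e.
have fu : f u = s by rewrite /f /two_level eqxx.
have fv : f v = s by rewrite /f /two_level eqxx orbT.
have fw a : (a != u) && (a != v) -> f a = t.
  by rewrite /f /two_level -negb_or => /negbTE ->.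
have f0 a : 0 <= f a by rewrite /f /two_level; case: ifP.
have sum_d a : d <= (dist e u a)%:R + (dist e v a)%:R.
  by rewrite -natrD ler_nat [dist e v a]sym_d dist_triangle.
rewrite (big_two_rest _ uv).
(* Rows [u] and [v] are added column by column, so that each column [b] carries the weight
   [d(u,b) + d(v,b)], at least [d]. *)
have ends : s * (d * (4 * s + m * (s + t))) <=
  f u * (\sum_b (dist e u b)%:R * (f u + f b)) + f v * (\sum_b (dist e v b)%:R * (f v + f b)).
  rewrite fu fv -mulrDr ler_wpM2l // -big_split /=.
  have -> : 4 * s + m * (s + t) = \sum_b (s + f b).
    rewrite (big_two_rest _ uv) fu fv.
    rewrite (eq_bigr (fun=> s + t)) => [|a /fw -> //].
    by rewrite sumr_const -[_ *+ _]mulr_natl -/m; ring.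
  rewrite mulr_sumr; apply: ler_sum => a _.
  by rewrite -mulrDl ler_wpM2r // addr_ge0.
apply: le_trans (lerD ends (_ : m * (t * (d * (s + t) + 2 * (m - 1) * t)) <= _)).
  by rewrite le_eqVlt; apply/orP; left; apply/eqP; ring.
(* In the row of another vertex [w], columns [u] and [v] together give at least [d * (s + t)],
   column [w] gives at least 0, and each of the [m - 1] remaining columns gives at least [2 * t],
   distinct vertices being at distance at least 1. *)
rewrite /m mulr_natl -sumr_const; apply: ler_sum => w wuv.
rewrite (fw w wuv) ler_wpM2l // (big_two_rest _ uv) fu fv; apply: lerD.
  by rewrite -mulrDl [t + s]addrC ler_wpM2r ?addr_ge0 // ![dist e w _]sym_d.
rewrite (bigD1 w) //= -[X in X <= _]add0r; apply: lerD.
  by rewrite mulr_ge0 // addr_ge0.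
have -> : 2 * (m - 1) * t = \sum_(a | ((a != u) && (a != v)) && (a != w)) 2 * t.
  have := sumr_const [pred a | (a != u) && (a != v)] (2 * t).
  rewrite (bigD1 w) //= -[RHS]mulr_natl -/m => E.
  by apply: (addrI (2 * t)); rewrite E; ring.
apply: ler_sum => a /andP[auv aw]; rewrite (fw a auv).
have -> : t + t = 2 * t by ring.
rewrite ler_peMl ?mulr_ge0 // ler1n dist_gt0 //.
by rewrite eq_sym.
Qed.


Lemma two_level_norm {R : realType} {T : finType} {u v : T} (s t : R)
    (f := two_level u v s t) : u != v ->
  \sum_a f a * f a
    = 2 * s ^+ 2 + #|[pred a | (a != u) && (a != v)]|%:R * t ^+ 2.
Proof.
move=> uv; rewrite (big_two_rest _ uv) /f /two_level !eqxx orbT.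
rewrite (eq_bigr (fun=> t * t)) => [|a].
  by rewrite sumr_const -[_ *+ _]mulr_natl -!expr2; ring.
by rewrite -negb_or => /negbTE ->.
Qed.

Lemma dsl_eigenvalue1_gt {R : realType} {T : finType} {e : rel T} {u v : T}
    (s t c : R) (d := (dist e u v)%:R : R)
    (m := #|[pred a | (a != u) && (a != v)]|%:R : R) :
    symmetric e -> connected_graph e -> u != v -> 0 <= s -> 0 <= t ->
    c * (2 * s ^+ 2 + m * t ^+ 2)
      < 4 * d * s ^+ 2 + d * m * (s + t) ^+ 2 + 2 * m * (m - 1) * t ^+ 2 ->
  c < dsl_eigenvalue R e 1.
Proof.
move=> sym_e conn_e uv s0 t0 c_lt; have sym_d := dist_sym sym_e conn_e.
apply: (symmetric_form_lt_eigenvalue1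
  (\row_i two_level u v s t (enum_val i))); first exact: dsl_sym.
rewrite dsl_form // dot_row_enum_val two_level_norm //.
by apply: lt_le_trans c_lt _; apply: dsl_two_level_ge.
Qed.

Theorem theorem6p1 (R : realType) (T : finType) (e : rel T) (n d : nat)
    (hsimple : simple_graph e) (hconn : connected_graph e)
    (hn : #|T| = n) (hd : diameter e = d) (hd3 : (3 <= d)%N) :
  dsl_eigenvalue R e 1 > 2 * n%:R - 4 + 2 * d%:R
  /\ ((4 <= d)%N -> dsl_eigenvalue R e 1 > d%:R * (n%:R + 2) / 2).
Proof.
have [sym_e _] := hsimple.
have [u [v duv]] : exists u v, dist e u v = d.
  by rewrite -hd; apply: diameter_attained; rewrite hd; apply: leq_trans hd3.
have uv : u != v.
  apply/eqP => uv; have := dist_le_walk (e := e) (u := u) (p := [::]) isT.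
  by rewrite [last _ _]uv duv; apply/negP; rewrite -ltnNge; apply: leq_trans hd3.
have cardT := card_two_rest uv.
have := dsl_eigenvalue1_gt (R := R) (e := e) (u := u) (v := v) _ _ _
  sym_e hconn uv.
set k := #|[pred a | (a != u) && (a != v)]| in cardT *; rewrite duv => eig_gt.
(* Here [3 <= d] and [d <= #|T| = k + 2]. *)
have k0 : (0 < k)%N.
  by move: (dist_le_card e u v); rewrite duv cardT => /(leq_trans hd3).
have nE : n%:R = k%:R + 2 :> R by rewrite -hn cardT -addn2 natrD.
have m1 : 1 <= k%:R :> R by rewrite ler1n.
have gt4 : (4 <= d)%N -> dsl_eigenvalue R e 1 > d%:R * (n%:R + 2) / 2.
  move=> d4; have {}d4 : 4 <= d%:R :> R by rewrite (ler_nat _ 4).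
  (* For this [c] and [t = 1] the [s ^+ 2] terms cancel, leaving a gap linear in [s] with slope
     [2 * d * m]. At [s = m + 4] the gap is [d * m * (3 * m / 2 + 7) + 2 * m * (m - 1)]. *)
  apply: (eig_gt (k%:R + 4) 1) => //; first by lra.
  rewrite nE; move: d4 m1; set m := k%:R; set D := d%:R => d4 m1.
  nra.
split=> //; case: (ltngtP d 3) hd3 => // [d4|d3] _.
  (* The comparison [2 * m + 2 * d <= d * (m + 4) / 2] amounts to [4 * m <= d * m]. *)
  apply: le_lt_trans (gt4 d4); rewrite nE.
  have {}d4 : 4 <= d%:R :> R by rewrite (ler_nat _ 4).
  move: d4 m1; set m := k%:R; set D := d%:R => d4 m1.
  nra.
(* Both sides contain [2 * m ^+ 2 + 108]; what remains is [42 * m < 46 * m]. *)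
apply: (eig_gt 3 1) => //; rewrite nE d3.
by move: m1; set m := k%:R => m1; nra.
Qed.
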